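(* Let $\mathsf{C}$ be a causal Markov category. (a) Composition in $\mathsf{ProbStoch}(\mathsf{C})$ is well-defined (i.e. the composition of $\mathsf{C}$ respects the almost sure equality relations), and $\mathsf{ProbStoch}(\mathsf{C})$ inherits the symmetric monoidal structure from $\mathsf{C}$. (b) If $\mathsf{C}$ has conditionals, then $\mathsf{ProbStoch}(\mathsf{C})$ is isomorphic to the category of couplings in $\mathsf{C}$.
   Context: A Markov category is a symmetric monoidal category $(\mathsf{C},\otimes,I)$ with symmetry $\mathsf{swap}_{X,Y}:X\otimes Y\to Y\otimes X$, in which every object $X$ is equipped with morphisms $\mathsf{copy}_X:X\to X\otimes X$ and $\mathsf{del}_X:X\to I$ forming a commutative comonoid (coassociative, counital, cocommutative), such that: (i) $\mathsf{del}_{X\otimes Y}$ is $\mathsf{del}_X\otimes\mathsf{del}_Y$ followed by $I\otimes I\cong I$; (ii) $\mathsf{copy}_{X\otimes Y}$ is $\mathsf{copy}_X\otimes\mathsf{copy}_Y$ followed by the canonical isomorphism $(X\otimes X)\otimes(Y\otimes Y)\cong(X\otimes Y)\otimes(X\otimes Y)$ swapping the two middle factors; (iii) $\mathsf{del}_Y\circ f=\mathsf{del}_X$ for every $f:X\to Y$. Associators and unitors are suppressed in formulas. Write $\mathsf{copy}^{(3)}_W:=(\mathsf{copy}_W\otimes\mathrm{id}_W)\circ\mathsf{copy}_W$. Almost sure equality: for $p:\Theta\to X$ and $f,g:X\to Y$, write $f=_{p\text{-a.s.}}g$ if $(\mathrm{id}_X\otimes f)\circ\mathsf{copy}_X\circ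 p=(\mathrm{id}_X\otimes g)\circ\mathsf{copy}_X\circ p$. Causal: $\mathsf{C}$ is causal if for all $f:A\to X$, $g:X\to Y$ and $h_1,h_2:Y\to Z$, the equation $(\mathrm{id}_Y\otimes h_1)\circ\mathsf{copy}_Y\circ g\circ f=(\mathrm{id}_Y\otimes h_2)\circ\mathsf{copy}_Y\circ g\circ f$ implies $\big(\mathrm{id}_X\otimes((\mathrm{id}_Y\otimes h_1)\circ\mathsf{copy}_Y\circ g)\big)\circ\mathsf{copy}_X\circ f=\big(\mathrm{id}_X\otimes((\mathrm{id}_Y\otimes h_2)\circ\mathsf{copy}_Y\circ g)\big)\circ\mathsf{copy}_X\circ f$. $\mathsf{ProbStoch}(\mathsf{C})$: objects are pairs $(X,\psi)$ with $X\in\mathsf{C}$ and $\psi:I\to X$; morphisms $(X,\psi)\to(Y,\phi)$ are the morphisms $f:X\to Y$ of $\mathsf{C}$ with $f\circ\psi=\phi$, modulo $\psi$-a.s. equality; composition is inherited from $\mathsf{C}$. The inherited monoidal structure is $(X,\psi)\otimes(Y,\phi):=(X\otimes Y,\ I\cong I\otimes I\xrightarrow{\psi\otimes\phi}X\otimes Y)$, and similarly on morphisms, with structure isomorphisms inherited from $\mathsf{C}$. $\mathsf{C}$ has conditionals if for every $f:A\to X\otimes Y$ there is $f_{|X}:X\otimes A\to Y$ such that $f=(\mathrm{id}_X\otimes f_{|X})\circ(\mathsf{copy}_X\otimes\mathrm{id}_A)\circ(f_X\otimes\mathrm{id}_A)\circ\mathsf{copy}_A$, where $f_X:=(\mathrm{id}_X\otimes\mathsf{del}_Y)\circ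 f$. Conditionals on another output factor are defined by first permuting the outputs. Conditional product: if $\mathsf{C}$ has conditionals, and $\psi:I\to X\otimes W$ and $\phi:I\to W\otimes Y$ have the same marginal $\omega:I\to W$, their conditional product is $\psi\otimes_W\phi:=(\psi_{|W}\otimes\mathrm{id}_W\otimes\phi_{|W})\circ\mathsf{copy}^{(3)}_W\circ\omega:I\to X\otimes W\otimes Y$, where $\psi_{|W}:W\to X$ and $\phi_{|W}:W\to Y$ are any conditionals (the result does not depend on the choice). Category of couplings (when $\mathsf{C}$ has conditionals): objects are pairs $(X,\pi_X)$ with $\pi_X:I\to X$; morphisms $(X,\pi_X)\to(Y,\pi_Y)$ are the morphisms $\psi:I\to X\otimes Y$ whose marginals on $X$ and $Y$ are $\pi_X$ and $\pi_Y$; composition of $\psi:(X,\pi_X)\to(W,\pi_W)$ and $\phi:(W,\pi_W)\to(Y,\pi_Y)$ is the conditional product $\psi\otimes_W\phi$ marginalized over $W$; the identity of $(X,\pi_X)$ is $\mathsf{copy}_X\circ\pi_X$. *)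

(* Defs.v *)
From HB Require Import structures.
From mathcomp Require Import all_boot.
From mathcomp Require Import boolp.

Set Implicit Arguments.
Unset Strict Implicit.
Unset Printing Implicit Defensive.

#[local] Obligation Tactic := idtac.

Declare Scope markov_scope.
Local Open Scope markov_scope.
Local Open Scope quotient_scope.

(* Each structure is split into its data and a predicate stating its laws, so
   that "this data satisfies the laws" can be the conclusion of a theorem.
   Equality of morphisms is Leibniz equality. *)

Record category_data := CategoryData {
  obj :> Type;
  hom : obj -> obj -> Type;
  idm : forall X, hom X X;
  comp : forall X Y Z, hom Y Z -> hom X Y -> hom X Z
}.

Notation "g ∘ f" := (comp g f) (at level 40, left associativity) : markov_scope.

Record is_category (C : category_data) : Prop := IsCategory {
  comp_id_l : forall (X Y : C) (f : hom X Y), idm Y ∘ f = f;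
  comp_id_r : forall (X Y : C) (f : hom X Y), f ∘ idm X = f;
  comp_assoc : forall (W X Y Z : C) (h : hom Y Z) (g : hom X Y) (f : hom W X),
    h ∘ (g ∘ f) = h ∘ g ∘ f
}.

Record functor (C D : category_data) := Functor {
  fobj :> C -> D;
  fmap : forall X Y : C, hom X Y -> hom (fobj X) (fobj Y);
  fmap_id : forall X : C, fmap (idm X) = idm (fobj X);
  fmap_comp : forall (X Y Z : C) (g : hom Y Z) (f : hom X Y),
    fmap (g ∘ f) = fmap g ∘ fmap f
}.

Definition functor_id (C : category_data) : functor C C :=
  @Functor C C (fun X => X) (fun X Y f => f)
    (fun=> erefl) (fun _ _ _ _ _ => erefl).

Program Definition functor_comp (C D E : category_data)
    (G : functor D E) (F : functor C D) : functor C E :=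
  @Functor C E (fun X => G (F X)) (fun X Y f => fmap G (fmap F f)) _ _.
Next Obligation. by move=> * /=; rewrite !fmap_id. Qed.
Next Obligation. by move=> * /=; rewrite !fmap_comp. Qed.

Definition isomorphic (C D : category_data) : Prop :=
  exists (F : functor C D) (G : functor D C),
    functor_comp G F = functor_id C /\ functor_comp F G = functor_id D.

Record monoidal_data := MonoidalData {
  mcat :> category_data;
  munit : mcat;
  tens : mcat -> mcat -> mcat;
  tensm : forall X X' Y Y' : mcat,
    hom X X' -> hom Y Y' -> hom (tens X Y) (tens X' Y');
  assoc : forall X Y Z, hom (tens (tens X Y) Z) (tens X (tens Y Z));
  assocV : forall X Y Z, hom (tens X (tens Y Z)) (tens (tens X Y) Z);
  lunit : forall X, hom (tens munit X) X;
  lunitV : forall X, hom X (tens munit X);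
  runit : forall X, hom (tens X munit) X;
  runitV : forall X, hom X (tens X munit);
  swap : forall X Y, hom (tens X Y) (tens Y X)
}.
Arguments munit {_}.

Notation "X ⊗ Y" := (tens X Y) (at level 30, right associativity)
  : markov_scope.
Notation "f ⊠ g" := (tensm f g) (at level 30, right associativity)
  : markov_scope.

Record is_symmetric_monoidal (C : monoidal_data) : Prop :=
    IsSymmetricMonoidal {
  smc_category : is_category C;
  tensm_id : forall X Y : C, idm X ⊠ idm Y = idm (X ⊗ Y);
  tensm_comp : forall (X X' X'' Y Y' Y'' : C)
      (g : hom X' X'') (f : hom X X') (g' : hom Y' Y'') (f' : hom Y Y'),
    (g ∘ f) ⊠ (g' ∘ f') = (g ⊠ g') ∘ (f ⊠ f');
  assocK : forall X Y Z : C, assocV X Y Z ∘ assoc X Y Z = idm _;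
  assocVK : forall X Y Z : C, assoc X Y Z ∘ assocV X Y Z = idm _;
  lunitK : forall X : C, lunitV X ∘ lunit X = idm _;
  lunitVK : forall X : C, lunit X ∘ lunitV X = idm _;
  runitK : forall X : C, runitV X ∘ runit X = idm _;
  runitVK : forall X : C, runit X ∘ runitV X = idm _;
  swapK : forall X Y : C, swap Y X ∘ swap X Y = idm _;
  assoc_nat : forall (X X' Y Y' Z Z' : C)
      (f : hom X X') (g : hom Y Y') (h : hom Z Z'),
    assoc X' Y' Z' ∘ ((f ⊠ g) ⊠ h) = (f ⊠ (g ⊠ h)) ∘ assoc X Y Z;
  lunit_nat : forall (X X' : C) (f : hom X X'),
    lunit X' ∘ (idm munit ⊠ f) = f ∘ lunit X;
  runit_nat : forall (X X' : C) (f : hom X X'),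
    runit X' ∘ (f ⊠ idm munit) = f ∘ runit X;
  swap_nat : forall (X X' Y Y' : C) (f : hom X X') (g : hom Y Y'),
    swap X' Y' ∘ (f ⊠ g) = (g ⊠ f) ∘ swap X Y;
  pentagon : forall W X Y Z : C,
    (idm W ⊠ assoc X Y Z) ∘ assoc W (X ⊗ Y) Z ∘ (assoc W X Y ⊠ idm Z)
    = assoc W X (Y ⊗ Z) ∘ assoc (W ⊗ X) Y Z;
  triangle : forall X Y : C,
    (idm X ⊠ lunit Y) ∘ assoc X munit Y = runit X ⊠ idm Y;
  hexagon : forall X Y Z : C,
    assoc Y Z X ∘ swap X (Y ⊗ Z) ∘ assoc X Y Z
    = (idm Y ⊠ swap X Z) ∘ assoc Y X Z ∘ (swap X Y ⊠ idm Z)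
}.

Definition middle_swap (C : monoidal_data) (W X Y Z : C) :
    hom ((W ⊗ X) ⊗ (Y ⊗ Z)) ((W ⊗ Y) ⊗ (X ⊗ Z)) :=
  assocV W Y (X ⊗ Z)
  ∘ (idm W ⊠ (assoc Y X Z ∘ (swap X Y ⊠ idm Z) ∘ assocV X Y Z))
  ∘ assoc W X (Y ⊗ Z).

Record markov_data := MarkovData {
  markov_monoidal :> monoidal_data;
  copy : forall X : markov_monoidal, hom X (X ⊗ X);
  del : forall X : markov_monoidal, hom X munit
}.

Record is_markov (C : markov_data) : Prop := IsMarkov {
  markov_smc : is_symmetric_monoidal C;
  copy_assoc : forall X : C,
    assoc X X X ∘ (copy X ⊠ idm X) ∘ copy X = (idm X ⊠ copy X) ∘ copy X;
  copy_del_l : forall X : C, lunit X ∘ (del X ⊠ idm X) ∘ copy X = idm X;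
  copy_del_r : forall X : C, runit X ∘ (idm X ⊠ del X) ∘ copy X = idm X;
  copy_swap : forall X : C, swap X X ∘ copy X = copy X;
  del_tens : forall X Y : C, del (X ⊗ Y) = lunit munit ∘ (del X ⊠ del Y);
  copy_tens : forall X Y : C,
    copy (X ⊗ Y) = middle_swap X X Y Y ∘ (copy X ⊠ copy Y);
  del_nat : forall (X Y : C) (f : hom X Y), del Y ∘ f = del X
}.

Record markov_category := MarkovCategory {
  markov_sort :> markov_data;
  markovP : is_markov markov_sort
}.

Section MarkovNotions.
Variable C : markov_category.
Implicit Types A T W X Y Z : C.

Definition as_eq T X Y (p : hom T X) (f g : hom X Y) : Prop :=
  (idm X ⊠ f) ∘ copy X ∘ p = (idm X ⊠ g) ∘ copy X ∘ p.

Definition causal : Prop :=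
  forall A X Y Z (f : hom A X) (g : hom X Y) (h1 h2 : hom Y Z),
    (idm Y ⊠ h1) ∘ copy Y ∘ g ∘ f = (idm Y ⊠ h2) ∘ copy Y ∘ g ∘ f ->
    (idm X ⊠ ((idm Y ⊠ h1) ∘ copy Y ∘ g)) ∘ copy X ∘ f
    = (idm X ⊠ ((idm Y ⊠ h2) ∘ copy Y ∘ g)) ∘ copy X ∘ f.

Definition marg1 A X Y (f : hom A (X ⊗ Y)) : hom A X :=
  runit X ∘ (idm X ⊠ del Y) ∘ f.

Definition marg2 A X Y (f : hom A (X ⊗ Y)) : hom A Y :=
  lunit Y ∘ (del X ⊠ idm Y) ∘ f.

Definition is_conditional A X Y (f : hom A (X ⊗ Y)) (k : hom (X ⊗ A) Y) :
    Prop :=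
  f = (idm X ⊠ k) ∘ assoc X X A ∘ (copy X ⊠ idm A) ∘ (marg1 f ⊠ idm A)
      ∘ copy A.

Definition has_conditionals : Prop :=
  forall A X Y (f : hom A (X ⊗ Y)), exists k, is_conditional f k.

Definition copy3 W : hom W ((W ⊗ W) ⊗ W) := (copy W ⊠ idm W) ∘ copy W.

Definition conditional (hc : has_conditionals) A X Y (f : hom A (X ⊗ Y)) :
    hom (X ⊗ A) Y := projT1 (cid (hc A X Y f)).

(* The conditional X -> Y of a state of X ⊗ Y, through X ≅ X ⊗ I. *)
Definition state_conditional (hc : has_conditionals) X Y
    (f : hom munit (X ⊗ Y)) : hom X Y := conditional hc f ∘ runitV X.

Definition cond_product W X Y (k : hom W X) (h : hom W Y)
    (omega : hom munit W) : hom munit ((X ⊗ W) ⊗ Y) :=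
  ((k ⊠ idm W) ⊠ h) ∘ copy3 W ∘ omega.

Definition discard_middle W X Y : hom ((X ⊗ W) ⊗ Y) (X ⊗ Y) :=
  (runit X ∘ (idm X ⊠ del W)) ⊠ idm Y.

End MarkovNotions.

Notation "f =[ p ]as g" := (as_eq p f g)
  (at level 70, p at level 200, no associativity, format "f  =[ p ]as  g")
  : markov_scope.

(* Objects of both ProbStoch(C) and the category of couplings. *)
Record prob_object (C : markov_category) := ProbObject {
  carrier :> C;
  state : hom munit carrier
}.
Arguments state {C} _.

(* What is needed for the structure isomorphisms of ProbStoch(C) to preserve
   states and for composites of couplings to have the right marginals. *)
Section Coherence.
Variable C : markov_category.
Implicit Types W X Y Z : C.

Let smcP := markov_smc (markovP C).
Let catP := smc_category smcP.
Let compA := comp_assoc catP.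
Let comp1f := comp_id_l catP.
Let compf1 := comp_id_r catP.

Lemma tensm_exch X X' Y Y' (f : hom X X') (g : hom Y Y') :
  (f ⊠ idm Y') ∘ (idm X ⊠ g) = (idm X' ⊠ g) ∘ (f ⊠ idm Y).
Proof. by rewrite -!(tensm_comp smcP) !comp1f !compf1. Qed.

Lemma tensm_comp1 X X' X'' Y (g : hom X' X'') (f : hom X X') :
  (g ⊠ idm Y) ∘ (f ⊠ idm Y) = (g ∘ f) ⊠ idm Y.
Proof. by rewrite -(tensm_comp smcP) comp1f. Qed.

Lemma tensm_1comp X Y Y' Y'' (g : hom Y' Y'') (f : hom Y Y') :
  (idm X ⊠ g) ∘ (idm X ⊠ f) = idm X ⊠ (g ∘ f).
Proof. by rewrite -(tensm_comp smcP) comp1f. Qed.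

Lemma munit_tens_inj X Y (f g : hom X Y) :
  idm (@munit C) ⊠ f = idm munit ⊠ g -> f = g.
Proof.
move=> E; rewrite -[f]compf1 -[g]compf1 -(lunitVK smcP).
by rewrite !compA -!(lunit_nat smcP) E.
Qed.

Lemma tens_munit_inj X Y (f g : hom X Y) :
  f ⊠ idm (@munit C) = g ⊠ idm munit -> f = g.
Proof.
move=> E; rewrite -[f]compf1 -[g]compf1 -(runitVK smcP).
by rewrite !compA -!(runit_nat smcP) E.
Qed.

Lemma lunitV_natM X Y (f : hom X Y) :
  lunitV Y ∘ f = (idm munit ⊠ f) ∘ lunitV X.
Proof.
rewrite -[RHS]comp1f -(lunitK smcP) -!compA; congr (_ ∘ _).
by rewrite compA (lunit_nat smcP) -compA (lunitVK smcP) compf1.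
Qed.

Lemma runitV_natM X Y (f : hom X Y) :
  runitV Y ∘ f = (f ⊠ idm munit) ∘ runitV X.
Proof.
rewrite -[RHS]comp1f -(runitK smcP) -!compA; congr (_ ∘ _).
by rewrite compA (runit_nat smcP) -compA (runitVK smcP) compf1.
Qed.

Lemma lunit_tens X Y : lunit (X ⊗ Y) ∘ assoc munit X Y = lunit X ⊠ idm Y.
Proof.
apply: munit_tens_inj.
have cancel (V : C) (f g : hom (munit ⊗ ((munit ⊗ X) ⊗ Y)) V) :
    f ∘ assoc _ _ _ ∘ (assoc _ _ _ ⊠ idm _)
    = g ∘ assoc _ _ _ ∘ (assoc _ _ _ ⊠ idm _) -> f = g.
  move=> E; rewrite -[f]compf1 -[g]compf1 -(assocVK smcP) !compA.
  rewrite -[f ∘ _]compf1 -[g ∘ _]compf1 -(tensm_id smcP) -(assocVK smcP).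
  by rewrite -tensm_comp1 !compA E.
apply: cancel; rewrite -tensm_1comp -!compA.
rewrite (compA (idm munit ⊠ assoc _ _ _)) (pentagon smcP).
rewrite compA (triangle smcP) -(tensm_id smcP) -(assoc_nat smcP).
by rewrite -(triangle smcP) compA -(assoc_nat smcP) -compA tensm_comp1.
Qed.

Lemma lunit_runit : lunit (@munit C) = runit (@munit C).
Proof.
apply: tens_munit_inj; rewrite -lunit_tens -(triangle smcP); congr (_ ∘ _).
by rewrite -[LHS]comp1f -(lunitK smcP) -compA -(lunit_nat smcP) compA
  (lunitK smcP) comp1f.
Qed.

Lemma lunit_swap X : lunit X ∘ swap X munit = runit X.
Proof.
apply: tens_munit_inj.
rewrite -[LHS]comp1f -[RHS]comp1f -(swapK smcP) -!compA; congr (_ ∘ _).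
rewrite -(triangle smcP) (compA _ (idm X ⊠ _)) [in RHS](swap_nat smcP).
rewrite -tensm_comp1 -!lunit_tens 2!compA -(lunit_nat smcP) -!compA.
by congr (_ ∘ _); rewrite !compA -(hexagon smcP).
Qed.

Lemma lunitV_runitV : lunitV (@munit C) = runitV (@munit C).
Proof.
by rewrite -[LHS]comp1f -(runitK smcP) -lunit_runit -compA (lunitVK smcP) compf1.
Qed.

Lemma swap_munit : swap (@munit C) munit = idm _.
Proof.
by rewrite -[LHS]comp1f -(lunitK smcP) -compA lunit_swap -lunit_runit.
Qed.

Lemma assoc_lunitV :
  assoc munit munit munit ∘ (lunitV (@munit C) ⊠ idm munit)
  = idm munit ⊠ lunitV munit.
Proof.
have E : (idm (@munit C) ⊠ lunitV munit) ∘ (idm munit ⊠ lunit munit) = idm _.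
  by rewrite tensm_1comp (lunitK smcP) (tensm_id smcP).
rewrite -[LHS]comp1f -{}E -compA (compA (idm munit ⊠ lunit munit)).
by rewrite (triangle smcP) -lunit_runit tensm_comp1 (lunitVK smcP)
  (tensm_id smcP) compf1.
Qed.

Lemma del_munit : del (@munit C) = idm munit.
Proof.
rewrite -(del_nat (markovP C) (runit munit ∘ copy munit)).
rewrite compA -(runit_nat smcP) -lunit_runit.
exact: (copy_del_l (markovP C)).
Qed.

Lemma copy_munit : copy (@munit C) = lunitV munit.
Proof.
rewrite -[RHS]compf1 -(copy_del_l (markovP C) munit) del_munit.
by rewrite (tensm_id smcP) compf1 compA (lunitK smcP) comp1f.
Qed.

Lemma marg1_swap X Y (f : hom munit (X ⊗ Y)) : marg1 (swap X Y ∘ f) = marg2 f.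
Proof.
rewrite /marg1 /marg2 !compA -lunit_swap; congr (_ ∘ _).
by rewrite -!compA -!(swap_nat smcP) (compA (swap _ _)) (swapK smcP) comp1f.
Qed.

Lemma marg2_swap X Y (f : hom munit (X ⊗ Y)) : marg2 (swap X Y ∘ f) = marg1 f.
Proof. by rewrite -marg1_swap compA (swapK smcP) comp1f. Qed.

Lemma state_conditional_marg (hc : has_conditionals C) X Y
    (f : hom munit (X ⊗ Y)) : state_conditional hc f ∘ marg1 f = marg2 f.
Proof.
rewrite /state_conditional /conditional; case: (cid _) => k /= fk.
rewrite [f in RHS]fk; move: (marg1 f) => m {fk}; rewrite /marg2 !compA.
rewrite -(compA (lunit Y)) tensm_exch compA (lunit_nat smcP).
rewrite -(compA _ (del X ⊠ _)) -(tensm_id smcP) -(assoc_nat smcP) compA.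
rewrite -(compA _ (lunit _) (assoc _ _ _)) -(compA k) lunit_tens -!compA.
rewrite (compA (lunit X ⊠ _)) tensm_comp1 (compA _ (copy X ⊠ _)) tensm_comp1.
rewrite (copy_del_l (markovP C)) (tensm_id smcP) comp1f.
by rewrite copy_munit lunitV_runitV runitV_natM.
Qed.

Lemma copy_delE_r W X (k : hom W X) :
  runit X ∘ ((k ⊠ del W) ∘ copy W) = k.
Proof.
rewrite -[k in k ⊠ _]compf1 -[del W]comp1f (tensm_comp smcP) -compA.
rewrite compA (runit_nat smcP) -!compA (compA (runit W)).
by rewrite (copy_del_r (markovP C)) compf1.
Qed.

Lemma copy_delE_l W X (k : hom W X) :
  lunit X ∘ ((del W ⊠ k) ∘ copy W) = k.
Proof.
rewrite -[k in _ ⊠ k]compf1 -[del W]comp1f (tensm_comp smcP) -compA.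
rewrite compA (lunit_nat smcP) -!compA (compA (lunit W)).
by rewrite (copy_del_l (markovP C)) compf1.
Qed.

Lemma discard_cond_product W X Y (k : hom W X) (h : hom W Y)
    (omega : hom munit W) :
  discard_middle W X Y ∘ cond_product k h omega = (k ⊠ h) ∘ copy W ∘ omega.
Proof.
rewrite /discard_middle /cond_product /copy3 !compA -!(tensm_comp smcP).
rewrite comp1f compf1 -!compA (compA (idm X ⊠ _)) -(tensm_comp smcP).
by rewrite comp1f compf1 copy_delE_r.
Qed.

Lemma marg1_comp W X Y (k : hom W X) (h : hom W Y)
    (omega : hom munit W) :
  marg1 ((k ⊠ h) ∘ copy W ∘ omega) = k ∘ omega.
Proof.
rewrite /marg1 !compA -!(compA (runit X)) -(tensm_comp smcP) comp1f.
by rewrite (del_nat (markovP C)) compA copy_delE_r.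
Qed.

Lemma marg2_comp W X Y (k : hom W X) (h : hom W Y)
    (omega : hom munit W) :
  marg2 ((k ⊠ h) ∘ copy W ∘ omega) = h ∘ omega.
Proof.
rewrite /marg2 !compA -!(compA (lunit Y)) -(tensm_comp smcP) comp1f.
by rewrite (del_nat (markovP C)) compA copy_delE_l.
Qed.

Lemma inverse_state X Y (f : hom X Y) (g : hom Y X) (p : hom munit X) q :
  g ∘ f = idm X -> f ∘ p = q -> g ∘ q = p.
Proof. by move=> gf <-; rewrite compA gf comp1f. Qed.

End Coherence.

Section ProbStoch.
Variable C : markov_category.

Let smcP := markov_smc (markovP C).
Let catP := smc_category smcP.
Let compA := comp_assoc catP.
Let comp1f := comp_id_l catP.
Let compf1 := comp_id_r catP.

Definition prob_unit : prob_object C := ProbObject (idm munit).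

Definition prob_tens (X Y : prob_object C) : prob_object C :=
  ProbObject ((state X ⊠ state Y) ∘ lunitV munit).

Implicit Types X Y Z : prob_object C.

Record state_map X Y := StateMap {
  state_map_val :> hom (carrier X) (carrier Y);
  state_mapP : state_map_val ∘ state X = state Y
}.

HB.instance Definition _ X Y := gen_eqMixin (state_map X Y).
HB.instance Definition _ X Y := gen_choiceMixin (state_map X Y).

Definition as_rel X Y : rel (state_map X Y) :=
  fun f g => `[< f =[state X]as g >].

Lemma as_rel_refl X Y : reflexive (@as_rel X Y).
Proof. by move=> f; apply/asboolP. Qed.

Lemma as_rel_sym X Y : symmetric (@as_rel X Y).
Proof. by move=> f g; apply: asbool_equiv_eq; split=> /esym. Qed.

Lemma as_rel_trans X Y : transitive (@as_rel X Y).
Proof.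
by move=> g f h /asboolP fg /asboolP gh; apply/asboolP; apply: etrans fg gh.
Qed.

Canonical as_equiv X Y :=
  EquivRel (@as_rel X Y) (@as_rel_refl X Y) (@as_rel_sym X Y)
    (@as_rel_trans X Y).

Definition ps_hom X Y : Type := {eq_quot as_equiv X Y}.

Definition ps_class X Y (f : state_map X Y) : ps_hom X Y :=
  \pi_({eq_quot as_equiv X Y}) f.

Program Definition sm_id X : state_map X X := @StateMap X X (idm _) _.
Next Obligation. by move=> X; rewrite comp1f. Qed.

Program Definition sm_comp X Y Z (g : state_map Y Z) (f : state_map X Y) :
    state_map X Z := @StateMap X Z (g ∘ f) _.
Next Obligation. by move=> * /=; rewrite -compA !state_mapP. Qed.

Program Definition sm_tensm X X' Y Y' (f : state_map X X')
    (g : state_map Y Y') : state_map (prob_tens X Y) (prob_tens X' Y') :=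
  @StateMap (prob_tens X Y) (prob_tens X' Y') (f ⊠ g) _.
Next Obligation.
by move=> * /=; rewrite compA -(tensm_comp smcP) !state_mapP.
Qed.

Program Definition sm_assoc X Y Z :
    state_map (prob_tens (prob_tens X Y) Z) (prob_tens X (prob_tens Y Z)) :=
  @StateMap (prob_tens (prob_tens X Y) Z) (prob_tens X (prob_tens Y Z))
    (assoc X Y Z) _.
Next Obligation.
move=> X Y Z /=; rewrite -[state Z in LHS]compf1 -[state X in RHS]compf1.
rewrite !(tensm_comp smcP) !compA (assoc_nat smcP) -!compA; congr (_ ∘ _).
by rewrite compA assoc_lunitV.
Qed.

Program Definition sm_assocV X Y Z :
    state_map (prob_tens X (prob_tens Y Z)) (prob_tens (prob_tens X Y) Z) :=
  @StateMap (prob_tens X (prob_tens Y Z)) (prob_tens (prob_tens X Y) Z)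
    (assocV X Y Z) _.
Next Obligation.
move=> X Y Z; exact: inverse_state (assocK smcP X Y Z)
  (state_mapP (sm_assoc X Y Z)).
Qed.

Program Definition sm_lunit X : state_map (prob_tens prob_unit X) X :=
  @StateMap (prob_tens prob_unit X) X (lunit X) _.
Next Obligation.
by move=> X /=; rewrite compA (lunit_nat smcP) -compA (lunitVK smcP) compf1.
Qed.

Program Definition sm_lunitV X : state_map X (prob_tens prob_unit X) :=
  @StateMap X (prob_tens prob_unit X) (lunitV X) _.
Next Obligation.
move=> X; exact: inverse_state (lunitK smcP X) (state_mapP (sm_lunit X)).
Qed.

Program Definition sm_runit X : state_map (prob_tens X prob_unit) X :=
  @StateMap (prob_tens X prob_unit) X (runit X) _.
Next Obligation.
move=> X /=; rewrite compA (runit_nat smcP) -compA lunitV_runitV.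
by rewrite (runitVK smcP) compf1.
Qed.

Program Definition sm_runitV X : state_map X (prob_tens X prob_unit) :=
  @StateMap X (prob_tens X prob_unit) (runitV X) _.
Next Obligation.
move=> X; exact: inverse_state (runitK smcP X) (state_mapP (sm_runit X)).
Qed.

Program Definition sm_swap X Y :
    state_map (prob_tens X Y) (prob_tens Y X) :=
  @StateMap (prob_tens X Y) (prob_tens Y X) (swap X Y) _.
Next Obligation.
by move=> X Y /=; rewrite compA (swap_nat smcP) swap_munit compf1.
Qed.

(* As usual for operations lifted to {eq_quot _}, composition and tensor are
   computed on chosen representatives; that they do not depend on the choice is
   a separate statement. *)
Definition ProbStoch_category : category_data := {|
  obj := prob_object C;
  hom := ps_hom;
  idm := fun X => ps_class (sm_id X);
  comp := fun X Y Z g f => ps_class (sm_comp (repr g) (repr f))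
|}.

Definition ProbStoch : monoidal_data := {|
  mcat := ProbStoch_category;
  munit := prob_unit;
  tens := prob_tens;
  tensm := fun X X' Y Y' f g => ps_class (sm_tensm (repr f) (repr g));
  assoc := fun X Y Z => ps_class (sm_assoc X Y Z);
  assocV := fun X Y Z => ps_class (sm_assocV X Y Z);
  lunit := fun X => ps_class (sm_lunit X);
  lunitV := fun X => ps_class (sm_lunitV X);
  runit := fun X => ps_class (sm_runit X);
  runitV := fun X => ps_class (sm_runitV X);
  swap := fun X Y => ps_class (sm_swap X Y)
|}.

End ProbStoch.

Section Couplings.
Variables (C : markov_category) (hc : has_conditionals C).
Implicit Types X Y W : prob_object C.

Record coupling X Y := Coupling {
  coupling_val :> hom munit (carrier X ⊗ carrier Y);
  coupling_marg1 : marg1 coupling_val = state X;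
  coupling_marg2 : marg2 coupling_val = state Y
}.

Program Definition coupling_id X : coupling X X :=
  @Coupling X X (copy X ∘ state X) _ _.
Next Obligation.
move=> X; have [smcP _ _ delr _ _ _ _] := markovP C.
by have [c1 _ cA] := smc_category smcP; rewrite /marg1 cA delr c1.
Qed.
Next Obligation.
move=> X; have [smcP _ dell _ _ _ _ _] := markovP C.
by have [c1 _ cA] := smc_category smcP; rewrite /marg2 cA dell c1.
Qed.

(* The conditional of [psi] on its second factor is a conditional of
   [swap _ _ ∘ psi] on its first. *)
Definition coupling_product X W Y (psi : coupling X W) (phi : coupling W Y) :
    hom munit ((carrier X ⊗ carrier W) ⊗ carrier Y) :=
  cond_product (state_conditional hc (swap X W ∘ psi))
    (state_conditional hc phi) (state W).

Program Definition coupling_comp X W Y (phi : coupling W Y)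
    (psi : coupling X W) : coupling X Y :=
  @Coupling X Y (discard_middle W X Y ∘ coupling_product psi phi) _ _.
Next Obligation.
move=> X W Y phi psi; rewrite /coupling_product discard_cond_product marg1_comp.
rewrite -(coupling_marg2 psi) -marg1_swap state_conditional_marg marg2_swap.
exact: coupling_marg1.
Qed.
Next Obligation.
move=> X W Y phi psi; rewrite /coupling_product discard_cond_product marg2_comp.
by rewrite -(coupling_marg1 phi) state_conditional_marg coupling_marg2.
Qed.

Definition Couplings : category_data := {|
  obj := prob_object C;
  hom := coupling;
  idm := coupling_id;
  comp := coupling_comp
|}.

End Couplings.

(* Main.v *)
(* Causality makes almost sure equality stable under precomposition:
   marginalizing its conclusion over the middle variable turns
   [g =_{f∘ψ} g'] into [g ∘ f =_ψ g' ∘ f].  With conditionals,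
   [f ↦ (id ⊗ f) ∘ copy ∘ ψ] is injective modulo almost sure equality by its
   very definition, and surjective onto couplings because a coupling is
   recovered from its first marginal and its conditional.  Being functorial and
   bijective on homs, it also transports the category laws to couplings. *)
From mathcomp Require Import all_boot.
From mathcomp Require Import boolp.
Require Import Defs.

Set Implicit Arguments.
Unset Strict Implicit.
Unset Printing Implicit Defensive.

Local Open Scope markov_scope.

(** * Almost sure equality under composition and tensor, and conditionals of states *)

Section AlmostSure.
Variable C : markov_category.
Implicit Types T W X Y Z : C.

Let smcP := markov_smc (markovP C).
Let catP := smc_category smcP.
Let compA := comp_assoc catP.
Let comp1f := comp_id_l catP.
Let compf1 := comp_id_r catP.

Lemma assocV_nat X X' Y Y' Z Z' (f : hom X X') (g : hom Y Y')
    (h : hom Z Z') :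
  assocV X' Y' Z' ∘ (f ⊠ (g ⊠ h)) = ((f ⊠ g) ⊠ h) ∘ assocV X Y Z.
Proof.
rewrite -[LHS]compf1 -(assocVK smcP) -!compA (compA (f ⊠ _)).
by rewrite -(assoc_nat smcP) !compA (assocK smcP) comp1f.
Qed.

Lemma middle_swap_nat W W' X X' Y Y' Z Z' (e : hom W W') (f : hom X X')
    (g : hom Y Y') (h : hom Z Z') :
  middle_swap W' X' Y' Z' ∘ ((e ⊠ f) ⊠ (g ⊠ h))
  = ((e ⊠ g) ⊠ (f ⊠ h)) ∘ middle_swap W X Y Z.
Proof.
have inner : (assoc Y' X' Z' ∘ (swap X' Y' ⊠ idm Z') ∘ assocV X' Y' Z')
    ∘ (f ⊠ (g ⊠ h))
  = (g ⊠ (f ⊠ h)) ∘ (assoc Y X Z ∘ (swap X Y ⊠ idm Z) ∘ assocV X Y Z).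
  rewrite -compA assocV_nat (compA _ ((f ⊠ g) ⊠ h)) -(compA _ (swap _ _ ⊠ _)).
  rewrite -(tensm_comp smcP) comp1f (swap_nat smcP) -[h in LHS]compf1.
  by rewrite (tensm_comp smcP) compA (assoc_nat smcP) -!compA.
rewrite /middle_swap -(compA _ (assoc _ _ _)) (assoc_nat smcP) compA.
rewrite -(compA (assocV _ _ _)) -(tensm_comp smcP) comp1f inner.
by rewrite -[e in LHS]compf1 (tensm_comp smcP) (compA (assocV _ _ _)) assocV_nat
  -!compA.
Qed.

Lemma runit_tens X Y :
  (idm X ⊠ runit Y) ∘ assoc X Y munit = runit (X ⊗ Y).
Proof.
(* Tensoring with the unit is faithful and [assoc] is invertible, so the claim may be checked after
   both; there the triangle identities reduce it to the pentagon. *)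
apply: tens_munit_inj; rewrite -[LHS]comp1f -[RHS]comp1f -(assocK smcP) -!compA.
congr (_ ∘ _); rewrite -tensm_comp1 -(triangle smcP) -(tensm_id smcP) !compA.
rewrite !(assoc_nat smcP) -(triangle smcP) -tensm_1comp -!compA; congr (_ ∘ _).
by rewrite -(pentagon smcP) !compA.
Qed.

Lemma assoc_runitV X Y :
  assoc X Y munit ∘ runitV (X ⊗ Y) = idm X ⊠ runitV Y.
Proof.
rewrite -[LHS]comp1f -(tensm_id smcP) -(runitK smcP) -tensm_1comp -!compA.
by rewrite (compA (idm X ⊠ runit Y)) runit_tens (runitVK smcP) compf1.
Qed.

Lemma as_eq_comp_l T X Y Z (p : hom T X) (f f' : hom X Y) (g : hom Y Z) :
  f =[p]as f' -> g ∘ f =[p]as g ∘ f'.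
Proof. by rewrite /as_eq -!tensm_1comp -!compA => ->. Qed.

Lemma causal_as_eq_comp_r T X Y Z (p : hom T X) (f : hom X Y)
    (g g' : hom Y Z) :
  causal C -> g =[f ∘ p]as g' -> g ∘ f =[p]as g' ∘ f.
Proof.
move=> hC; rewrite /as_eq !compA => /hC.
(* Deleting the copy of [Y] from the joint map [(idm Y ⊠ h) ∘ copy Y ∘ f] leaves [h ∘ f], so the
   equation supplied by causality can be marginalized. *)
have E h : idm X ⊠ (h ∘ f) = (idm X ⊠ (lunit Z ∘ (del Y ⊠ idm Z)))
    ∘ (idm X ⊠ ((idm Y ⊠ h) ∘ copy Y ∘ f)).
  rewrite tensm_1comp -!compA (compA (del Y ⊠ _)) -(tensm_comp smcP).
  by rewrite comp1f compf1 (compA _ _ f) (compA (lunit _)) copy_delE_l.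
by rewrite !E -!compA => ->.
Qed.

(** Copying a tensor copies each factor and then swaps the middle ones. By naturality [f ⊠ g] slides
    under that swap, which leaves the tensor of the two given equations. *)
Lemma as_eq_tensm S T X X' Y Y' (p : hom S X) (q : hom T Y)
    (f f' : hom X X') (g g' : hom Y Y') :
  f =[p]as f' -> g =[q]as g' -> f ⊠ g =[p ⊠ q]as f' ⊠ g'.
Proof.
move=> Ef Eg; rewrite /as_eq (copy_tens (markovP C)) -!(tensm_id smcP).
rewrite !(compA _ (middle_swap _ _ _ _)) -!middle_swap_nat.
rewrite -!(compA (middle_swap _ _ _ _)); congr (_ ∘ _).
by rewrite -!(tensm_comp smcP) Ef Eg.
Qed.

(** Needed because the state of [prob_tens] is a tensor of states precomposed with a unitor. *)
Lemma as_eq_precomp S T X Y (p : hom T X) (r : hom S T) (f f' : hom X Y) :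
  f =[p]as f' -> f =[p ∘ r]as f'.
Proof. by rewrite /as_eq !compA => ->. Qed.

(** This is the defining equation of a conditional with parameter object [munit]: copying [munit] is
    a unitor, which slides through to [k] by naturality and coherence. *)
Lemma state_conditionalE (hc : has_conditionals C) X Y
    (psi : hom munit (X ⊗ Y)) :
  (idm X ⊠ state_conditional hc psi) ∘ copy X ∘ marg1 psi = psi.
Proof.
rewrite /state_conditional /conditional; case: (cid _) => k /= E.
rewrite {2}E; move: (marg1 psi) => m {E}.
rewrite copy_munit lunitV_runitV -(compA _ (m ⊠ _)) -runitV_natM compA.
rewrite -(compA _ (copy X ⊠ _)) -runitV_natM compA -(compA _ (assoc _ _ _)).
by rewrite assoc_runitV tensm_1comp.
Qed.

End AlmostSure.

(** * Passage to the quotient by almost sure equality *)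

Section ProbStochLaws.
Variables (C : markov_category) (hC : causal C).
Implicit Types X Y Z : prob_object C.

Let smcP := markov_smc (markovP C).
Let catP := smc_category smcP.

Lemma sm_comp_as_eq X Y Z (f f' : state_map X Y) (g g' : state_map Y Z) :
  f =[state X]as f' -> g =[state Y]as g' ->
  sm_comp g f =[state X]as sm_comp g' f'.
Proof.
move=> Ef Eg; apply: etrans (as_eq_comp_l g Ef) _.
by apply: causal_as_eq_comp_r => //; rewrite state_mapP.
Qed.

Lemma sm_tensm_as_eq X X' Y Y' (f f' : state_map X X') (g g' : state_map Y Y') :
  f =[state X]as f' -> g =[state Y]as g' ->
  sm_tensm f g =[state (prob_tens X Y)]as sm_tensm f' g'.
Proof. by move=> Ef Eg; apply/as_eq_precomp/as_eq_tensm. Qed.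

Lemma ps_classE X Y (f g : state_map X Y) :
  f =[state X]as g -> ps_class f = ps_class g.
Proof. by move=> E; apply/eqmodP/asboolP. Qed.

Lemma ps_class_inj X Y (f g : state_map X Y) :
  ps_class f = ps_class g -> f =[state X]as g.
Proof. by move=> /eqmodP/asboolP. Qed.

Lemma repr_ps_class X Y (f : state_map X Y) :
  repr (ps_class f) =[state X]as f.
Proof. by apply: ps_class_inj; rewrite /ps_class reprK. Qed.

(* Composition and tensor of [ProbStoch C] are convertible to classes, so
   rewriting with "a composite of classes is the class of the composite" would
   match wrongly; this predicate is recursed on syntactically instead. *)
Definition represents X Y (f : @hom (ProbStoch C) X Y) (f0 : state_map X Y) :
    Prop := f = ps_class f0.

Lemma represents_class X Y (f : state_map X Y) : represents (ps_class f) f.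
Proof. by []. Qed.

Lemma represents_repr X Y (f : ps_hom X Y) : represents f (repr f).
Proof. by rewrite /represents /ps_class reprK. Qed.

(** The chosen representatives differ from [g0] and [f0] only almost surely, and well-definedness of
    composition absorbs the difference. *)
Lemma represents_comp X Y Z (g : @hom (ProbStoch C) Y Z)
    (f : @hom (ProbStoch C) X Y) g0 f0 :
  represents g g0 -> represents f f0 -> represents (g ∘ f) (sm_comp g0 f0).
Proof. by move=> -> ->; apply/ps_classE/sm_comp_as_eq; apply: repr_ps_class. Qed.

Lemma represents_tensm X X' Y Y' (f : @hom (ProbStoch C) X X')
    (g : @hom (ProbStoch C) Y Y') f0 g0 :
  represents f f0 -> represents g g0 -> represents (f ⊠ g) (sm_tensm f0 g0).
Proof. by move=> -> ->; apply/ps_classE/sm_tensm_as_eq; apply: repr_ps_class. Qed.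

Lemma represents_eq X Y (f g : @hom (ProbStoch C) X Y) f0 g0 :
  represents f f0 -> represents g g0 ->
  f0 = g0 :> hom (carrier X) (carrier Y) -> f = g.
Proof. by move=> -> -> E; apply: ps_classE; rewrite /as_eq E. Qed.

Ltac represent :=
  lazymatch goal with
  | |- represents (comp _ _) _ => apply: represents_comp; represent
  | |- represents (tensm _ _) _ => apply: represents_tensm; represent
  | _ => first [exact: represents_class | exact: represents_repr]
  end.

(** [represent] computes representatives of both sides by recursion on their syntax; these are then
    equal in [C] on the nose, by the corresponding law. *)
Ltac inherit law :=
  intros; eapply represents_eq; [represent | represent | apply law].

Lemma ProbStoch_is_category : is_category (ProbStoch C).
Proof.
split.
- inherit (comp_id_l catP).
- inherit (comp_id_r catP).
- inherit (comp_assoc catP).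
Qed.

Lemma ProbStoch_is_symmetric_monoidal : is_symmetric_monoidal (ProbStoch C).
Proof.
split; first exact: ProbStoch_is_category.
- inherit (tensm_id smcP).
- inherit (tensm_comp smcP).
- inherit (assocK smcP).
- inherit (assocVK smcP).
- inherit (lunitK smcP).
- inherit (lunitVK smcP).
- inherit (runitK smcP).
- inherit (runitVK smcP).
- inherit (swapK smcP).
- inherit (assoc_nat smcP).
- inherit (lunit_nat smcP).
- inherit (runit_nat smcP).
- inherit (swap_nat smcP).
- inherit (pentagon smcP).
- inherit (triangle smcP).
- inherit (hexagon smcP).
Qed.

End ProbStochLaws.

(** * Identity-on-objects functors that are bijective on morphisms *)

Section HomBijection.

(** Both functors share the object map [F], so their actions on morphisms have the same type and are
    compared without transport; the laws are proof-irrelevant. *)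
Lemma functor_eq (C D : category_data) (F : C -> D)
    (m m' : forall X Y, hom X Y -> hom (F X) (F Y)) p q p' q' :
  (forall X Y f, m X Y f = m' X Y f) ->
  @Functor C D F m p q = @Functor C D F m' p' q'.
Proof.
move=> E; have {}E : m = m'.
  by do 3![apply: functional_extensionality_dep => ?]; apply: E.
by case: m' / E p' q' => p' q'; congr Functor; apply: Prop_irrelevance.
Qed.

Variables (O : Type) (homC homD : O -> O -> Type).
Variables (idC : forall X, homC X X) (idD : forall X, homD X X).
Variable compC : forall X Y Z, homC Y Z -> homC X Y -> homC X Z.
Variable compD : forall X Y Z, homD Y Z -> homD X Y -> homD X Z.
Let C := CategoryData idC compC.
Let D := CategoryData idD compD.

Variables (F : forall X Y, homC X Y -> homD X Y).
Variables (G : forall X Y, homD X Y -> homC X Y).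
Hypotheses (FK : forall X Y, cancel (@F X Y) (@G X Y)).
Hypotheses (GK : forall X Y, cancel (@G X Y) (@F X Y)).
Hypothesis F_id : forall X, F (idC X) = idD X.
Hypothesis F_comp : forall X Y Z (g : homC Y Z) (f : homC X Y),
  F (compC g f) = compD (F g) (F f).

Lemma isomorphic_hom_bij : isomorphic C D.
Proof.
have G_id X : G (idD X) = idC X by rewrite -F_id FK.
have G_comp X Y Z (g : homD Y Z) (f : homD X Y) :
    G (compD g f) = compC (G g) (G f) by rewrite -[RHS]FK F_comp !GK.
exists (@Functor C D id F F_id F_comp), (@Functor D C id G G_id G_comp).
by split; apply: functor_eq => X Y f; [apply: FK | apply: GK].
Qed.

(** Spares a direct verification that composing couplings by marginalized conditional products is
    associative. *)
Lemma is_category_hom_bij : is_category C -> is_category D.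
Proof.
case=> c1 c2 cA; split=> /=.
- move=> X Y f; rewrite -[f]GK -F_id -F_comp; congr F; apply: c1.
- move=> X Y f; rewrite -[f]GK -F_id -F_comp; congr F; apply: c2.
- move=> W X Y Z h g f.
  rewrite -[f]GK -[g]GK -[h]GK -!F_comp; congr F; apply: cA.
Qed.

End HomBijection.

(** * Couplings as maps modulo almost sure equality *)

Section CouplingIso.
Variables (C : markov_category) (hC : causal C) (hc : has_conditionals C).
Implicit Types W X Y Z : prob_object C.

Let smcP := markov_smc (markovP C).
Let catP := smc_category smcP.
Let compA := comp_assoc catP.
Let comp1f := comp_id_l catP.
Let compf1 := comp_id_r catP.

Lemma coupling_inj X Y (psi phi : coupling X Y) :
  psi = phi :> hom munit (carrier X ⊗ carrier Y) -> psi = phi.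
Proof.
case: psi phi => [psi p q] [phi p' q'] /= E.
by case: phi / E p' q' => p' q'; congr Coupling; apply: Prop_irrelevance.
Qed.

Lemma graph_marg1 X Y (f : state_map X Y) :
  marg1 ((idm (carrier X) ⊠ f) ∘ copy (carrier X) ∘ state X) = state X.
Proof. by rewrite marg1_comp comp1f. Qed.

Lemma graph_marg2 X Y (f : state_map X Y) :
  marg2 ((idm (carrier X) ⊠ f) ∘ copy (carrier X) ∘ state X) = state Y.
Proof. by rewrite marg2_comp state_mapP. Qed.

Definition graph_coupling X Y (f : state_map X Y) : coupling X Y :=
  Coupling (graph_marg1 f) (graph_marg2 f).

Lemma coupling_conditional_state X Y (psi : coupling X Y) :
  state_conditional hc psi ∘ state X = state Y.
Proof.
by rewrite -(coupling_marg1 psi) state_conditional_marg coupling_marg2.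
Qed.

Definition coupling_conditional X Y (psi : coupling X Y) : state_map X Y :=
  StateMap (coupling_conditional_state psi).

Definition coupling_of_ps X Y (f : ps_hom X Y) : coupling X Y :=
  graph_coupling (repr f).

Definition ps_of_coupling X Y (psi : coupling X Y) : ps_hom X Y :=
  ps_class (coupling_conditional psi).

(** Almost sure equality with respect to [state X] is literally equality of the underlying states of
    the graph couplings. *)
Lemma coupling_of_ps_class X Y (f : state_map X Y) :
  coupling_of_ps (ps_class f) = graph_coupling f.
Proof. exact/coupling_inj/repr_ps_class. Qed.

Lemma coupling_conditionalK X Y :
  cancel (@coupling_conditional X Y) (@graph_coupling X Y).
Proof.
move=> psi; apply: coupling_inj => /=.
by rewrite -(coupling_marg1 psi) state_conditionalE.
Qed.

Lemma ps_of_couplingK X Y :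
  cancel (@ps_of_coupling X Y) (@coupling_of_ps X Y).
Proof.
by move=> psi; rewrite coupling_of_ps_class coupling_conditionalK.
Qed.

Lemma coupling_of_psK X Y :
  cancel (@coupling_of_ps X Y) (@ps_of_coupling X Y).
Proof.
move=> f; rewrite [RHS](represents_repr f); apply: ps_classE.
exact: (congr1 (@coupling_val _ _ _)
  (coupling_conditionalK (graph_coupling (repr f)))).
Qed.

Lemma coupling_of_ps_id X :
  coupling_of_ps (ps_class (sm_id X)) = coupling_id X.
Proof.
rewrite coupling_of_ps_class; apply: coupling_inj => /=.
by rewrite (tensm_id smcP) comp1f.
Qed.

Lemma graph_coupling_comp X Y Z (g : state_map Y Z) (f : state_map X Y) :
  graph_coupling (sm_comp g f)
  = coupling_comp hc (graph_coupling g) (graph_coupling f).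
Proof.
apply: coupling_inj => /=; rewrite /coupling_product discard_cond_product.
set psi := coupling_val (graph_coupling f).
(* [l] goes from [Y] back to [X]: it is a Bayesian inverse of [f], and [El] rebuilds the graph of
   [f] from [state Y] with it. *)
set l := state_conditional hc (swap _ _ ∘ _).
have El : (l ⊠ idm (carrier Y)) ∘ copy (carrier Y) ∘ state Y = psi.
  have := state_conditionalE hc (swap _ _ ∘ psi).
  rewrite marg1_swap (coupling_marg2 (graph_coupling f)) -/l => El.
  rewrite -[RHS]comp1f -(swapK smcP) -(compA _ _ psi) -El !compA (swap_nat smcP).
  by rewrite -(compA _ (swap _ _)) (copy_swap (markovP C)).
have /= := congr1 (@coupling_val _ _ _)
  (coupling_conditionalK (graph_coupling g)).
(* [Eg] says that [k] equals [g] almost surely, so [g] may replace it; [g] then slides past [l], and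
   [El] turns the rest into the graph of [f]. *)
set k := state_conditional hc _ => Eg.
have -> : l ⊠ k = (l ⊠ idm _) ∘ (idm _ ⊠ k).
  by rewrite -(tensm_comp smcP) comp1f compf1.
rewrite -!(compA (l ⊠ _)) Eg !compA tensm_exch -!(compA (idm _ ⊠ g)) El.
by rewrite /psi /= !compA tensm_1comp.
Qed.

Lemma coupling_of_ps_comp X Y Z (g : ps_hom Y Z) (f : ps_hom X Y) :
  coupling_of_ps (ps_class (sm_comp (repr g) (repr f)))
  = coupling_comp hc (coupling_of_ps g) (coupling_of_ps f).
Proof. by rewrite coupling_of_ps_class graph_coupling_comp. Qed.

End CouplingIso.

Theorem proposition13p9 (C : markov_category) (hC : causal C) :
  ((forall (X Y Z : prob_object C) (f f' : state_map X Y)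
       (g g' : state_map Y Z),
       f =[state X]as f' -> g =[state Y]as g' ->
       sm_comp g f =[state X]as sm_comp g' f')
   /\ (forall (X X' Y Y' : prob_object C) (f f' : state_map X X')
         (g g' : state_map Y Y'),
         f =[state X]as f' -> g =[state Y]as g' ->
         sm_tensm f g =[state (prob_tens X Y)]as sm_tensm f' g')
   /\ is_symmetric_monoidal (ProbStoch C))
  /\
  (forall hc : has_conditionals C,
     is_category (Couplings hc) /\ isomorphic (ProbStoch C) (Couplings hc)).
Proof.
split; [split; [|split] | move=> hc; split].
- by move=> X Y Z f f' g g'; apply: sm_comp_as_eq.
- by move=> X X' Y Y' f f' g g'; apply: sm_tensm_as_eq.
- exact: ProbStoch_is_symmetric_monoidal.
- exact: (is_category_hom_bij (@ps_of_couplingK C hc)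
    (@coupling_of_ps_id C) (@coupling_of_ps_comp C hc)
    (ProbStoch_is_category hC)).
- exact: (isomorphic_hom_bij (@coupling_of_psK C hc) (@ps_of_couplingK C hc)
    (@coupling_of_ps_id C) (@coupling_of_ps_comp C hc)).
Qed.
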